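(* Let $k\ge 1$ be a fixed integer, and for $n\ge k+1$ let $N=\binom{n}{k+1}$ and $r=r(n)$ with $0\le r\le N$. Let $F$ and $G$ be independent, uniformly chosen subsets of size $r$ of the $N$-element set $C_{n,k}=\binom{[n]}{k+1}$, and let $T=|F\cap G|$. Then the random variable $T$ follows a hypergeometric distribution with parameters $(N,r,r)$. If $r=o(\sqrt{N})$ as $n\to\infty$, then $T$ converges in distribution to a Poisson random variable with parameter $$\lambda=\frac{r^2}{N},$$ i.e. $\mathbb{P}(T=t)-e^{-\lambda}\frac{\lambda^t}{t!}\to 0$ as $n\to\infty$ for every integer $t\ge 0$. Moreover, there exists an absolute constant $C>0$ such that for every integer $t\ge 0$, $$\left|\mathbb{P}(T=t)-e^{-\lambda}\frac{\lambda^t}{t!}\right|\le C\,\frac{r^3}{N^2}.$$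
   Context: $[n]=\{1,\dots,n\}$ and $\binom{[n]}{k+1}$ denotes the set of its $(k+1)$-element subsets (called circuits). The hypergeometric distribution with parameters $(N,r,r)$ is given by $\mathbb{P}(T=t)=\binom{r}{t}\binom{N-r}{r-t}/\binom{N}{r}$. Absolute constant means independent of $n$, $k$, $r$, $t$. *)

(* Defs.v *)
From mathcomp Require Import all_boot all_order all_algebra.
From mathcomp Require Import all_classical all_reals all_analysis.

Set Implicit Arguments.
Unset Strict Implicit.
Unset Printing Implicit Defensive.

Import Order.TTheory GRing.Theory Num.Theory.
Import numFieldNormedType.Exports.

Local Open Scope classical_set_scope.
Local Open Scope ring_scope.

(* [n] is represented by 'I_n = {0, ..., n-1}. *)
Definition circuits (n k : nat) : {set {set 'I_n}} :=
  [set A : {set 'I_n} | #|A| == k.+1]%SET.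

(* For a countable target U this also says that X is measurable with respect
   to the discrete sigma-algebra on U. *)
Definition has_pmf (R : realType) (d : measure_display) (W : measurableType d)
    (P : probability W R) (U : Type) (X : W -> U) (p : U -> R) : Prop :=
  forall u : U, measurable (X @^-1` [set u]) /\
    P (X @^-1` [set u]) = (p u)%:E.

Definition uniform_on (R : realType) (d : measure_display)
    (W : measurableType d) (P : probability W R) (U : finType)
    (S : {set U}) (X : W -> U) : Prop :=
  has_pmf P X (fun u => (u \in S)%:R / #|S|%:R).

(* Intended for discrete targets, where every subset is an event. *)
Definition independent_rv (R : realType) (d : measure_display)
    (W : measurableType d) (P : probability W R) (U V : Type)
    (X : W -> U) (Y : W -> V) : Prop :=
  forall (A : set U) (B : set V),
    P (X @^-1` A `&` Y @^-1` B) = (P (X @^-1` A) * P (Y @^-1` B))%E.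

(* Parameters (N, r, r).  For t > r the truncated r - t is harmless, because
   the factor 'C(r, t) vanishes. *)
Definition hypergeometric_pmf (R : realType) (N r t : nat) : R :=
  ('C(r, t) * 'C(N - r, r - t))%:R / 'C(N, r)%:R.

(* The library's poisson_pmf is not used: at rate 0 it is constantly 1, whereas
   here lambda = 0 (that is, r = 0) is allowed and must give the Dirac mass at
   0, with the convention 0 ^+ 0 = 1. *)
Definition poisson_mass (R : realType) (lambda : R) (t : nat) : R :=
  expR (- lambda) * (lambda ^+ t / t`!%:R).

(* Main.v *)
Require Import Defs.
From mathcomp Require Import all_boot all_order all_algebra.
From mathcomp Require Import all_classical all_reals all_analysis.
From mathcomp Require Import ring lra.

Set Implicit Arguments.
Unset Strict Implicit.
Unset Printing Implicit Defensive.

Import Order.TTheory GRing.Theory Num.Theory.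
Import numFieldNormedType.Exports.

Local Open Scope classical_set_scope.
Local Open Scope ring_scope.

(** That #|F :&: G| is hypergeometric is a count: for a fixed r-subset A of an
    N-element set C, an r-subset B of C with #|A :&: B| = u is the disjoint
    union of a u-subset of A and an (r - u)-subset of C minus A.

    The Poisson bound, which holds with the constant 4, is Stein's method with a
    point test function. Put x = r^2/N, let p be the Poisson mass function of
    parameter x > 0 and h the hypergeometric one. Fix t and let f solve
    [x f(j+1) - j f(j) = [j = t] - p t]. Averaging this equation over h gives
    [h t - p t = E (x f(T+1) - T f(T))], so it remains to bound the right-hand
    side.

    - The function f is explicit in terms of the partial sums of p, and
      log-concavity of p yields |f| <= 1 whatever x and t are
      ([stein_solution_norm_le1]).
    - The ratio of h (j+1) to h j is a rational function of j, which, after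
      summation against any phi, reads
      [E ((r-T)^2 phi(T+1)) = E (T (N-2r+T) phi(T))]
      ([hypergeometric_shift]). For phi = 1 this is E T = x; for phi = f it
      turns N times the right-hand side into
      [E ((2r-T) T (f(T+1) - f(T)))].

    As 0 <= T <= r, the last expectation is at most
    2r * E T * 2 = 4 r^3/N in absolute value; dividing by N gives 4 r^3/N^2.
    This covers large x as well as small x, because the bound wanted is
    proportional to x r/N, so that a bound on f uniform in x suffices.

    When r = o(sqrt N), this tends to 0, because
    r^3/N^2 = (r/sqrt N)^3 / sqrt N and N >= 1. *)

(** * Poisson weights and the solution of the Stein equation *)

Section PoissonMass.
Variables (R : realType) (x : R).
Hypothesis x_gt0 : 0 < x.
Implicit Types (t i j d m : nat).

Local Notation p := (poisson_mass x).

Lemma poisson_mass_gt0 t : 0 < p t.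
Proof.
by rewrite mulr_gt0 ?expR_gt0// divr_gt0 ?exprn_gt0// ltr0n fact_gt0.
Qed.

Lemma poisson_mass_ge0 t : 0 <= p t.
Proof. exact/ltW/poisson_mass_gt0. Qed.

Lemma poisson_massS t : p t.+1 * t.+1%:R = x * p t.
Proof.
have t_neq0 : t.+1%:R != 0 :> R by rewrite pnatr_eq0.
have tf_neq0 : t`!%:R != 0 :> R by rewrite pnatr_eq0 -lt0n fact_gt0.
rewrite /poisson_mass exprS factS natrM.
move: t.+1%:R t`!%:R t_neq0 tf_neq0 => a b a_neq0 b_neq0.
by field; apply/andP.
Qed.

Lemma poisson_massS_le t : p t.+1 <= x * p t.
Proof.
by rewrite -poisson_massS ler_peMr ?poisson_mass_ge0// ler1n.
Qed.

Lemma sum_poisson_mass m :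
  \sum_(i < m) p i = expR (- x) * series (exp_coeff x) m.
Proof. by rewrite -mulr_sumr /series /= big_mkord. Qed.

Lemma sum_poisson_mass_cvg : \sum_(i < m) p i @[m --> \oo] --> (1 : R).
Proof.
under eq_fun do rewrite sum_poisson_mass.
rewrite -(expR0 R) -(addNr x) expRD.
by apply: cvgMr; exact: is_cvg_series_exp_coeff.
Qed.

Lemma sum_poisson_mass_le1 m : \sum_(i < m) p i <= 1.
Proof.
rewrite -(cvg_lim (@Rhausdorff R) sum_poisson_mass_cvg).
apply: nondecreasing_cvgn_le (cvgP _ sum_poisson_mass_cvg) _.
apply/nondecreasing_seqP => a.
by rewrite big_ord_recr/= lerDl poisson_mass_ge0.
Qed.

(** The ratio p (k+1) / p k = x / (k+1) decreases with k. *)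
Lemma poisson_mass_log_concave i j d :
  (i <= j)%N -> p i * p (j + d) <= p j * p (i + d).
Proof.
move=> ij; elim: d => [|d IH]; first by rewrite !addn0 mulrC.
have pS k : p (k + d.+1) = x / (k + d).+1%:R * p (k + d).
  rewrite addnS; apply: (mulIf (_ : (k + d).+1%:R != 0)).
    by rewrite pnatr_eq0.
  by rewrite poisson_massS; field.
rewrite !pS (mulrCA (p i)) (mulrCA (p j)) ler_pM//.
- by rewrite divr_ge0 // ltW.
- by rewrite mulr_ge0// poisson_mass_ge0.
- by rewrite ler_pM2l// lef_pV2 ?posrE ?ltr0n// ler_nat ltnS leq_add2r.
Qed.

Lemma sum_poisson_mass_shift_le1 a m : \sum_(i < m) p (a + i) <= 1.
Proof.
apply: le_trans (sum_poisson_mass_le1 (a + m)).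
rewrite big_split_ord/= lerDr sumr_ge0// => i _.
exact: poisson_mass_ge0.
Qed.

(** The Stein equation read as a recursion. The equation multiplies the value
    at 0 by 0, so any value of absolute value at most 1 would do there. *)
Fixpoint stein_solution t j : R :=
  if j is i.+1
  then (i%:R * stein_solution t i + (i == t)%:R - p t) / x
  else 0.

Local Notation f := stein_solution.

Lemma stein_equation t j : x * f t j.+1 - j%:R * f t j = (j == t)%:R - p t.
Proof. by rewrite /= mulrC divfK ?lt0r_neq0//; ring. Qed.

(** Multiplying the Stein equation by p j makes its left-hand side telescope,
    as j p j = x p (j-1); this is the solution by an integrating factor. *)
Lemma stein_solutionE t j :
  x * p j * f t j.+1 = p t * ((t <= j)%:R - \sum_(i < j.+1) p i).
Proof.
have step i : x * p i * f t i.+1 =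
    p i * i%:R * f t i + p i * (i == t)%:R - p i * p t.
  by have := stein_equation t i; move=> /(canRL (subrK _)) E;
     rewrite mulrAC E; ring.
elim: j => [|j IH].
  rewrite step mulr0 add0r big_ord1 leqn0 eq_sym.
  by case: eqP => [->|_] /=; ring.
rewrite step poisson_massS IH [X in _ = _ * (_ - X)]big_ord_recr/=.
rewrite (leq_eqVlt t j.+1) ltnS eq_sym.
case: (t =P j.+1) => [->|_] /=; last by ring.
by rewrite ltnn /=; ring.
Qed.

(** Below t the solution is governed by the head of the Poisson weights. With
    t = s+1, log-concavity moves each product p s * p i to p j * p (s-j+i), and
    the shifted weights still sum to at most 1. *)
Lemma stein_head_bound t j :
  (j < t)%N -> p t * \sum_(i < j.+1) p i <= x * p j.
Proof.
case: t => // s; rewrite ltnS => js.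
have p_ge0 := poisson_mass_ge0.
have S_ge0 m : 0 <= \sum_(i < m) p i by rewrite sumr_ge0.
apply: le_trans (ler_wpM2r (S_ge0 _) (poisson_massS_le s)) _.
rewrite -mulrA ler_pM2l//.
apply: (@le_trans _ _ (p j * \sum_(i < j.+1) p (s - j + i))); last first.
  by rewrite ler_piMr// sum_poisson_mass_shift_le1.
rewrite !mulr_sumr ler_sum// => i _.
have := @poisson_mass_log_concave i j (s - j) (ltn_ord i).
by rewrite subnKC// [X in X <= _]mulrC (addnC i).
Qed.

(** From t on the solution is governed by the tail of the Poisson weights, which
    is reached through its finite sections: p t * p (j+1+i) is at most
    x * p t * p (j+i), which log-concavity moves to x * p j * p (t+i). *)
Lemma stein_tail_bound t j :
  (t <= j)%N -> p t * (1 - \sum_(i < j.+1) p i) <= x * p j.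
Proof.
move=> tj; rewrite mulrC -ler_pdivlMr ?poisson_mass_gt0// lerBlDl.
rewrite -[leLHS](cvg_lim (@Rhausdorff R) sum_poisson_mass_cvg).
apply: limr_le; first exact: cvgP sum_poisson_mass_cvg.
near=> M.
have -> : M = (j.+1 + (M - j.+1))%N.
  by rewrite subnKC//; near: M; exact: nbhs_infty_ge.
move: (M - j.+1)%N => m.
rewrite big_split_ord/= lerD2l ler_pdivlMr ?poisson_mass_gt0// mulr_suml.
apply: (@le_trans _ _ (x * p j * \sum_(i < m) p (t + i))); last first.
  rewrite ler_piMr ?sum_poisson_mass_shift_le1//.
  by rewrite mulr_ge0 ?poisson_mass_ge0// ltW.
rewrite mulr_sumr ler_sum// => i _.
have pt_ge0 := poisson_mass_ge0 t.
apply: le_trans (ler_wpM2r pt_ge0 (poisson_massS_le (j + i))) _.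
by rewrite -!(mulrA x) ler_pM2l// [leLHS]mulrC poisson_mass_log_concave.
Unshelve. all: by end_near.
Qed.

Lemma stein_solution_norm_le1 t j : `|f t j| <= 1.
Proof.
case: j => [|j]; first by rewrite normr0.
have xp_gt0 : 0 < x * p j by rewrite mulr_gt0// poisson_mass_gt0.
have pt_ge0 := poisson_mass_ge0 t.
rewrite -(ler_pM2l xp_gt0) mulr1.
rewrite -[X in X * `|_|](gtr0_norm xp_gt0) -normrM stein_solutionE.
case: leqP => tj.
  rewrite ger0_norm ?stein_tail_bound//.
  by rewrite mulr_ge0// subr_ge0 sum_poisson_mass_le1.
rewrite sub0r mulrN normrN ger0_norm ?stein_head_bound// mulr_ge0//.
by rewrite sumr_ge0// => i _; rewrite poisson_mass_ge0.
Qed.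

End PoissonMass.

(** * Poisson approximation of the hypergeometric weights *)

Section Hypergeometric.
Variables (R : realType) (N r : nat).
Hypothesis rN : (r <= N)%N.
Implicit Types (t j : nat) (phi : nat -> R).

Local Notation h := (hypergeometric_pmf R N r).

Lemma hypergeometric_pmf_ge0 t : 0 <= h t.
Proof. by rewrite divr_ge0. Qed.

Lemma hypergeometric_pmf_gt t : (r < t)%N -> h t = 0.
Proof. by move=> rt; rewrite /hypergeometric_pmf bin_small// mul0r. Qed.

Lemma sum_hypergeometric_pmf : \sum_(j < r.+1) h j = 1.
Proof.
rewrite -mulr_suml -natr_sum binomial.Vandermonde subnKC// divff//.
by rewrite pnatr_eq0 -lt0n bin_gt0.
Qed.

(** Detailed balance for the walk that swaps a random element of G with a random
    element of its complement, F being held fixed. From #|F :&: G| = j there are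
    (r-j)^2 swaps that lead to j+1, and from j+1 there are (j+1)(N-2r+j+1) that
    lead back to j. When N-2r+j+1 is negative, h (j+1) = 0. *)
Lemma hypergeometric_balance j :
  h j.+1 * (j.+1%:R * (N%:R - r%:R *+ 2 + j.+1%:R)) = h j * (r%:R - j%:R) ^+ 2.
Proof.
have [jr|] := ltnP j r; last first.
  rewrite leq_eqVlt => /predU1P[<-|rj].
    by rewrite subrr expr0n/= mulr0 hypergeometric_pmf_gt// mul0r.
  by rewrite !hypergeometric_pmf_gt ?mul0r// ltnW.
pose i := (r - j.+1)%N.
have rj : (r - j = i.+1)%N by rewrite subnSK.
have rE : r%:R = j%:R + 1 + i%:R :> R.
  by rewrite -(natrD _ j 1) addn1 -natrD subnKC.
have first_factor : 'C(r, j.+1)%:R * j.+1%:R = 'C(r, j)%:R * i.+1%:R :> R.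
  by rewrite -!natrM mulnC mul_bin_left rj mulnC.
have second_factor : 'C(N - r, i)%:R * ((N - r)%:R - i%:R) =
    'C(N - r, i.+1)%:R * i.+1%:R :> R.
  rewrite -natrM [in RHS]mulnC mul_bin_left natrM mulrC.
  have [/natrB->//|Ni] := leqP i (N - r).
  by rewrite bin_small// !mulr0.
rewrite /hypergeometric_pmf rj -/i !natrM.
have -> : N%:R - r%:R *+ 2 + j.+1%:R = (N - r)%:R - i%:R :> R.
  by rewrite (natrB _ rN) rE -[in LHS]natr1; ring.
have -> : r%:R - j%:R = i.+1%:R :> R by rewrite rE -natr1; ring.
set c := _^-1.
transitivity ('C(r, j.+1)%:R * j.+1%:R *
    ('C(N - r, i)%:R * ((N - r)%:R - i%:R)) * c).
  by ring.
by rewrite first_factor second_factor; ring.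
Qed.

(** The balance equation summed against phi; the boundary terms vanish because
    of the factors r - j at j = r and j at j = 0. *)
Lemma hypergeometric_shift phi :
  \sum_(j < r.+1) h j * ((r%:R - j%:R) ^+ 2 * phi j.+1) =
  \sum_(j < r.+1) h j * (j%:R * (N%:R - r%:R *+ 2 + j%:R) * phi j).
Proof.
rewrite big_ord_recr/= subrr expr0n/= mul0r mulr0 addr0.
rewrite big_ord_recl/= !mul0r mulr0 add0r.
by apply: eq_bigr => j _; rewrite mulrA -hypergeometric_balance -[LHS]mulrA.
Qed.

(** The case phi = 1 of the previous identity, as
    (r-j)^2 - j(N-2r+j) = r^2 - N j. *)
Lemma hypergeometric_mean : N%:R * \sum_(j < r.+1) h j * j%:R = r%:R ^+ 2.
Proof.
have /eqP := hypergeometric_shift (fun=> 1).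
rewrite -subr_eq0 -sumrB => /eqP shift0.
have r2E : \sum_(j < r.+1) r%:R ^+ 2 * h j = r%:R ^+ 2.
  by rewrite -mulr_sumr sum_hypergeometric_pmf mulr1.
apply/esym/eqP; rewrite -[eqbLHS]r2E mulr_sumr -subr_eq0 -sumrB -[eqbRHS]shift0.
by apply/eqP/eq_bigr => j _; ring.
Qed.

Hypothesis N_gt0 : (0 < N)%N.

(** Stein's method. The case r = 0 is apart because the Stein recursion divides
    by the parameter; both laws are then the Dirac mass at 0. *)
Lemma hypergeometric_poisson t :
  `|h t - poisson_mass (r%:R ^+ 2 / N%:R) t|
    <= 4 * (r%:R ^+ 3 / N%:R ^+ 2).
Proof.
have NR_gt0 : 0 < N%:R :> R by rewrite ltr0n.
have [r0|r_gt0] := posnP r.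
  rewrite r0 /hypergeometric_pmf /poisson_mass !expr0n/= !mul0r oppr0 mulr0.
  rewrite expR0 mul1r expr0n sub0n !bin0 bin0n muln1 divr1.
  by case: t => [|t]; rewrite /= ?mul0r ?divr1 subrr normr0.
set x := _ / _; set p := poisson_mass x.
have x_gt0 : 0 < x by rewrite divr_gt0// exprn_gt0// ltr0n.
set f := stein_solution x t.
have Nx : N%:R * x = r%:R ^+ 2 by rewrite /x mulrC divfK// gt_eqF.
have h_sum : h t = \sum_(j < r.+1) h j * ((j : nat) == t)%:R.
  have [tr|rt] := ltnP t r.+1.
    rewrite (bigD1 (Ordinal tr))//= eqxx mulr1 big1 ?addr0// => j /negPf.
    by rewrite -val_eqE/= => ->; rewrite mulr0.
  rewrite hypergeometric_pmf_gt// big1// => j _.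
  by rewrite ltn_eqF ?mulr0// (leq_trans (ltn_ord j)).
(* The Stein equation averaged over h, simplified by hypergeometric_shift. *)
have key : N%:R * (h t - p t) =
    \sum_(j < r.+1) h j * ((r%:R *+ 2 - j%:R) * j%:R * (f j.+1 - f j)).
  have pE : \sum_(j < r.+1) h j * p t = p t.
    by rewrite -mulr_suml sum_hypergeometric_pmf mul1r.
  have /eqP := hypergeometric_shift f; rewrite -subr_eq0 -sumrB => /eqP shift0.
  rewrite h_sum -[in LHS]pE -sumrB mulr_sumr.
  apply/eqP; rewrite -subr_eq0 -sumrB -[eqbRHS]shift0.
  apply/eqP/eq_bigr => j _; rewrite -mulrBr -(stein_equation x_gt0 t j) -/f.
  transitivity (h j * (N%:R * x * f j.+1 - N%:R * j%:R * f j
      - (r%:R *+ 2 - j%:R) * j%:R * (f j.+1 - f j))); first by ring.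
  by rewrite Nx; ring.
rewrite -(ler_pM2l NR_gt0) -[X in X * `|_|](gtr0_norm NR_gt0) -normrM key.
apply: le_trans (ler_norm_sum _ _ _) _.
apply: (@le_trans _ _ (\sum_(j < r.+1) h j * j%:R * (r%:R *+ 4))).
  apply: ler_sum => j _; rewrite normrM ger0_norm ?hypergeometric_pmf_ge0//.
  rewrite -[leRHS]mulrA ler_wpM2l ?hypergeometric_pmf_ge0//.
  have jr : j%:R <= r%:R :> R by rewrite ler_nat -ltnS.
  have j_ge0 : 0 <= j%:R :> R by [].
  have rj_ge0 : 0 <= r%:R *+ 2 - j%:R :> R by lra.
  rewrite !normrM (ger0_norm rj_ge0) (ger0_norm j_ge0).
  have df : `|f j.+1 - f j| <= 2.
    apply: le_trans (ler_normB _ _) _.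
    by have := lerD (stein_solution_norm_le1 x_gt0 t j.+1)
      (stein_solution_norm_le1 x_gt0 t j).
  have : (r%:R *+ 2 - j%:R) * `|f j.+1 - f j| <= r%:R *+ 2 * 2 :> R.
    by apply: ler_pM => //; lra.
  by move/(ler_wpM2l j_ge0); rewrite mulrA (mulrC j%:R) => /le_trans -> //; lra.
rewrite -mulr_suml -(ler_pM2l NR_gt0) [leLHS]mulrA hypergeometric_mean.
rewrite le_eqVlt; apply/orP; left; apply/eqP.
by field; rewrite gt_eqF.
Qed.

End Hypergeometric.

(** * Laws of functions of finitely valued random elements *)

Section FiniteRandomElements.
Variables (R : realType) (d : measure_display) (W : measurableType d).
Variable P : probability W R.

Lemma has_pmf_comp (U : finType) (V : eqType) (X : W -> U) (p : U -> R)
    (g : U -> V) :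
  has_pmf P X p -> has_pmf P (g \o X) (fun v => \sum_(u | g u == v) p u).
Proof.
move=> Xp v.
have -> : (g \o X) @^-1` [set v] =
    \bigcup_(u in [set` [pred u | g u == v]]) X @^-1` [set u].
  apply/seteqP; split=> [w /= gXw|w [u /= /eqP gu /= ->]//].
  by exists (X w) => //=; apply/eqP.
have mX u : measurable (X @^-1` [set u]) by have [] := Xp u.
have fin : finite_set [set` [pred u | g u == v]] by exact: finite_finpred.
split; first exact: fin_bigcup_measurable.
rewrite measure_fin_bigcup//; last first.
  by move=> u u' _ _ [w [/= -> ->]].
rewrite -sumEFin (@bigfs _ _ _ _ (index_enum U)) ?index_enum_uniq//; last first.
  by move=> u _; rewrite mem_index_enum.
by apply: eq_fsbigr => u _; have [] := Xp u.
Qed.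

Lemma has_pmf_pair (U V : Type) (X : W -> U) (Y : W -> V)
    (p : U -> R) (q : V -> R) :
  has_pmf P X p -> has_pmf P Y q -> independent_rv P X Y ->
  has_pmf P (fun w => (X w, Y w)) (fun uv => p uv.1 * q uv.2).
Proof.
move=> Xp Yq XY [u v] /=.
have -> : (fun w => (X w, Y w)) @^-1` [set (u, v)] =
    X @^-1` [set u] `&` Y @^-1` [set v].
  by apply/seteqP; split=> w /= [-> ->].
have [mX PX] := Xp u; have [mY PY] := Yq v.
by split; [exact: measurableI|rewrite XY PX PY EFinM].
Qed.

End FiniteRandomElements.

(** * The size of the intersection of two uniform subsets *)

(** B is determined by the pair (A :&: B, B :\: A), and such pairs are free in
    the product of the u-subsets of A with the (#|A| - u)-subsets of C :\: A. *)
Lemma card_subsets_meeting (U : finType) (C A : {set U}) (u : nat) :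
  A \subset C ->
  #|[set B : {set U} | [&& B \subset C, #|B| == #|A| & #|A :&: B| == u]]%SET| =
  ('C(#|A|, u) * 'C(#|C| - #|A|, #|A| - u))%N.
Proof.
move=> AC; have [uA|Au] := leqP u #|A|; last first.
  rewrite bin_small// mul0n; apply: eq_card0 => B; rewrite !inE.
  apply/negP => /and3P[_ _ /eqP uE].
  by have := subset_leq_card (subsetIl A B); rewrite uE leqNgt Au.
have -> : (#|C| - #|A| = #|C :\: A|)%N.
  by rewrite cardsD (finset.setIidPr AC).
rewrite -!cards_draws -cardsX.
set S := finset.setX _ _.
have inS D E : ((D, E) \in S) = [&& D \subset A, #|D| == u,
    E \subset C :\: A & #|E| == #|A| - u]%N.
  by rewrite !inE /= -andbA.
have SI D E : (D, E) \in S -> A :&: (D :|: E) = D /\ (D :|: E) :\: A = E.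
  rewrite inS => /and4P[DA _ EC _]; move: EC; rewrite finset.subsetD.
  move=> /andP[_ EA]; split.
    rewrite finset.setIUr (finset.setIidPr DA) finset.setIC.
    by rewrite (disjoint_setI0 EA) finset.setU0.
  rewrite finset.setDUl (finset.setDidPl EA).
  by move: DA; rewrite -finset.setD_eq0 => /eqP ->; rewrite finset.set0U.
rewrite -(@card_in_imset _ _ (fun DE => DE.1 :|: DE.2)); last first.
  move=> [D E] [D' E'] /= /SI[DI EI] /SI[DI' EI'] DE.
  by congr pair; [rewrite -DI DE DI'|rewrite -EI DE EI'].
apply: eq_card => B; rewrite inE; apply/and3P/imsetP.
  move=> [BC /eqP BA /eqP Bu]; exists (A :&: B, B :\: A).
    rewrite inS finset.subsetIl Bu eqxx finset.setSD//=.
    by rewrite cardsD finset.setIC Bu BA.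
  by rewrite /= finset.setIC finset.setID.
move=> [[D E] DE ->] /=; have [DI EI] := SI _ _ DE.
move: DE; rewrite inS => /and4P[DA /eqP Du EC /eqP Eu].
split.
- rewrite finset.subUset (fintype.subset_trans DA AC).
  exact: fintype.subset_trans EC (finset.subsetDl _ _).
- by rewrite -(cardsID A (D :|: E)) finset.setIC DI EI Du Eu subnKC.
- by rewrite DI Du.
Qed.

(** Given F = A, the count of the admissible G does not depend on A; hence the
    average over A of its quotient by 'C(#|C|, r) is that quotient. *)
Lemma has_pmf_card_setI (R : realType) (d : measure_display)
    (W : measurableType d) (P : probability W R) (U : finType) (C : {set U})
    (r : nat) (F G : W -> {set U}) :
  let S := [set A : {set U} | (A \subset C) && (#|A| == r)]%SET in
  (r <= #|C|)%N -> uniform_on P S F -> uniform_on P S G ->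
  independent_rv P F G ->
  has_pmf P (fun w => #|F w :&: G w|) (hypergeometric_pmf R #|C| r).
Proof.
move=> S rC uF uG FG t.
have cardS : #|S| = 'C(#|C|, r) by rewrite cards_draws.
have := has_pmf_comp (fun AB : {set U} * {set U} => #|AB.1 :&: AB.2|)
  (has_pmf_pair uF uG FG) t.
move=> [mT PT]; split; first exact: mT.
rewrite [LHS]PT; congr EFin.
rewrite /hypergeometric_pmf cardS; set c : R := 'C(#|C|, r)%:R.
have c_neq0 : c != 0 by rewrite pnatr_eq0 -lt0n bin_gt0.
have count A : A \in S -> \sum_(B | #|A :&: B| == t) (B \in S)%:R =
    ('C(r, t) * 'C(#|C| - r, r - t))%:R :> R.
  rewrite inE => /andP[AC /eqP Ar].
  rewrite -[in RHS]Ar -card_subsets_meeting// -sum1_card natr_sum.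
  rewrite big_mkcond [RHS]big_mkcond; apply: eq_bigr => B _.
  rewrite !inE Ar; case: (B \subset C); case: (#|B| == r) => //=;
    by case: (_ == t).
rewrite (eq_bigl (fun AB => xpredT AB.1 && (#|AB.1 :&: AB.2| == t)))//.
rewrite -(pair_big_dep xpredT (fun A B => #|A :&: B| == t)
  (fun A B => (A \in S)%:R / c * ((B \in S)%:R / c)))/=.
transitivity (\sum_(A in S) (('C(r, t) * 'C(#|C| - r, r - t))%:R / c / c)).
  rewrite [RHS]big_mkcond; apply: eq_bigr => A _; rewrite -mulr_sumr -mulr_suml.
  case: ifPn => AS; last by rewrite !mul0r.
  by rewrite count// mul1r mulrC.
by rewrite sumr_const cardS -[LHS]mulr_natr -/c divfK.
Qed.

(** * The random circuits *)

Lemma card_circuits n k : #|circuits n k| = 'C(n, k.+1).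
Proof. by rewrite card_draws card_ord. Qed.

Theorem theorem7p1 (R : realType) :
  exists C : R, 0 < C /\
  forall (k : nat) (r : nat -> nat)
    (d : nat -> measure_display) (W : forall n : nat, measurableType (d n))
    (P : forall n : nat, probability (W n) R)
    (F G : forall n : nat, W n -> {set {set 'I_n}}),
  let N := fun n : nat => 'C(n, k.+1) in
  let T := fun (n : nat) (w : W n) => #|F n w :&: G n w| in
  let lambda := fun n : nat => (r n)%:R ^+ 2 / (N n)%:R : R in
  let rsubsets := fun n : nat =>
    [set A : {set {set 'I_n}} | (A \subset circuits n k) && (#|A| == r n)]%SET in
  (1 <= k)%N ->
  (forall n : nat, (k.+1 <= n)%N ->
    [/\ (r n <= N n)%N,
        uniform_on (P n) (rsubsets n) (F n),
        uniform_on (P n) (rsubsets n) (G n) &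
        independent_rv (P n) (F n) (G n)]) ->
  [/\ forall n : nat, (k.+1 <= n)%N ->
        has_pmf (P n) (T n) (hypergeometric_pmf R (N n) (r n)),
      (fun n : nat => (r n)%:R : R) =o_\oo
        (fun n : nat => Num.sqrt (N n)%:R : R) ->
      forall t : nat,
        (fun n : nat => fine (P n (T n @^-1` [set t])) -
                        poisson_mass (lambda n) t) @ \oo --> (0 : R) &
      forall n t : nat, (k.+1 <= n)%N ->
        `|fine (P n (T n @^-1` [set t])) - poisson_mass (lambda n) t|
          <= C * ((r n)%:R ^+ 3 / (N n)%:R ^+ 2)].
Proof.
exists 4; split=> // k r d W P F G N T lambda rsubsets _ model.
have N_gt0 n : (k.+1 <= n)%N -> (0 < N n)%N by rewrite bin_gt0.
have pmfT n : (k.+1 <= n)%N ->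
    has_pmf (P n) (T n) (hypergeometric_pmf R (N n) (r n)).
  move=> kn; have [rN uF uG FG] := model n kn.
  have := has_pmf_card_setI _ uF uG FG.
  by rewrite card_circuits; exact.
have bound n t : (k.+1 <= n)%N ->
    `|fine (P n (T n @^-1` [set t])) - poisson_mass (lambda n) t|
      <= 4 * ((r n)%:R ^+ 3 / (N n)%:R ^+ 2).
  move=> kn; have [_ ->] := pmfT n kn t.
  have [rN _ _ _] := model n kn.
  exact: hypergeometric_poisson (N_gt0 n kn) t.
split=> // /eqoP small t; apply/cvgr0Pnorm_lt => e e_gt0.
(* r <= c sqrt N gives 4 r^3/N^2 <= 4 c^3 <= 4 c, and 4 (e/5) < e. *)
pose c := Num.min 1 (e / 5).
have c_gt0 : 0 < c by rewrite lt_min ltr01 divr_gt0.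
near=> n.
have kn : (k.+1 <= n)%N by near: n; exact: nbhs_infty_ge.
apply: le_lt_trans (bound n t kn) _.
set s : R := Num.sqrt (N n)%:R.
have s_ge1 : 1 <= s by rewrite -sqrtr1 ler_wsqrtr// ler1n N_gt0.
have s_gt0 : 0 < s by exact: lt_le_trans s_ge1.
have NE : (N n)%:R = s ^+ 2 by rewrite sqr_sqrtr.
have rs : (r n)%:R <= c * s.
  have : `|(r n)%:R : R| <= c * `|Num.sqrt (N n)%:R : R|.
    by near: n; exact: (small c c_gt0).
  by rewrite !ger0_norm// ltW.
apply: (@le_lt_trans _ _ (4 * c)).
  rewrite ler_pM2l// NE ler_pdivrMr ?exprn_gt0//.
  have c_ge0 := ltW c_gt0; have s_ge0 := ltW s_gt0.
  have c_le1 : c <= 1 by rewrite ge_min lexx.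
  apply: (@le_trans _ _ ((c * s) ^+ 3)).
    by rewrite lerXn2r ?nnegrE// mulr_ge0.
  have c3 : c ^+ 3 <= c by rewrite exprSr ler_piMl// exprn_ile1.
  have s3 : s ^+ 3 <= (s ^+ 2) ^+ 2 by rewrite -exprM ler_weXn2l.
  by rewrite exprMn ler_pM// exprn_ge0.
have : c <= e / 5 by rewrite ge_min lexx orbT.
lra.
Unshelve. all: by end_near.
Qed.
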